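(* Let $X$ be a Gromov hyperbolic metric space and let $\partial_\infty X$ be its Gromov boundary. Then $\partial_\infty X$ is doubling for any Bourdon metric if and only if it is doubling for any Hamenstädt metric. (Here a Bourdon metric is a metric $d_{w,\varepsilon}$ on $\partial_\infty X$, and a Hamenstädt metric is a metric $\sigma_{b,\varepsilon}$ on a punctured boundary $\partial_\infty X\setminus\{\xi\}$ with $\xi\in\partial_\infty X$, as defined in the context.)
   Context: A metric space is doubling if there is a constant $C$ such that every metric ball $B$ can be covered by at most $C$ balls of half the radius of $B$. Gromov hyperbolicity: for a metric space $(X,d)$ the Gromov product is $(x|y)_w=\frac12[d(x,w)+d(y,w)-d(x,y)]$. $X$ is Gromov ($\delta$-)hyperbolic if for some $\delta\ge 0$, $(x|y)_w\ge\min\{(x|z)_w,(z|y)_w\}-\delta$ for all $x,y,z,w\in X$. Gromov boundary: a sequence $\{x_i\}$ in $X$ is a Gromov sequence if $(x_i|x_j)_w\to\infty$ as $i,j\to\infty$; two Gromov sequences $\{x_i\},\{y_i\}$ are equivalent if $(x_i|y_i)_w\to\infty$; $\partial_\infty X$ is the set of equivalence classes. For $a\in X$ and $\eta,\xi\in\partial_\infty X$, $(a|\eta)_w=\inf\{\liminf_{i}(a|b_i)_w:\{b_i\}\in\eta\}$ and $(\xi|\eta)_w=\inf\{\liminf_i(a_i|b_i)_w:\{a_i\}\in\xi,\{b_i\}\in\eta\}$. Bourdon metric: for $w\in X$ and $0<\varepsilon<\min\{1,\frac1{5\delta}\}$ put $\rho_{w,\varepsilon}(\xi,\zeta)=e^{-\varepsilon(\xi|\zeta)_w}$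 (with $e^{-\infty}=0$) on $\partial_\infty X$, and $d_{w,\varepsilon}(\xi,\zeta)=\inf\sum_{i=1}^n\rho_{w,\varepsilon}(\xi_{i-1},\xi_i)$, the infimum over all $n\ge1$ and finite chains $\xi=\xi_0,\dots,\xi_n=\zeta$ in $\partial_\infty X$. Then $d_{w,\varepsilon}$ is a metric with $\rho_{w,\varepsilon}/2\le d_{w,\varepsilon}\le\rho_{w,\varepsilon}$, called the Bourdon metric based at $w$ with parameter $\varepsilon$. Hamenstädt metric: for $\xi\in\partial_\infty X$ and $w\in X$, the Busemann function based at $\xi$ is $b(x)=b_{\xi,w}(x)=(\xi|w)_x-(\xi|x)_w$, $x\in X$. Put $(x|y)_b=\frac12(b(x)+b(y)-d(x,y))$ for $x,y\in X$, and $(\xi_1|\xi_2)_b=\inf\{\liminf_i(x_i|y_i)_b:\{x_i\}\in\xi_1,\{y_i\}\in\xi_2\}$ for $\xi_1,\xi_2\in\partial_\infty X\setminus\{\xi\}$. For $\varepsilon>0$ with $e^{22\varepsilon\delta}\le2$, put $\rho_{b,\varepsilon}(\xi_1,\xi_2)=e^{-\varepsilon(\xi_1|\xi_2)_b}$ and $\sigma_{b,\varepsilon}(x,y)=\inf\sum_{i=1}^n\rho_{b,\varepsilon}(x_{i-1},x_i)$, the infimum over all $n\ge1$ and finite chains $x=x_0,\dots,x_n=y$ in $\partial_\infty X\setminus\{\xi\}$. Then $\sigma_{b,\varepsilon}$ is a metric on $\partial_\infty X\setminus\{\xi\}$ with $\rho_{b,\varepsilon}/2\le\sigma_{b,\varepsilon}\le\rho_{b,\varepsilon}$,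 called the Hamenstädt metric based at $\xi$ (or at $b$) with parameter $\varepsilon$. *)

(* Defs.v *)
From mathcomp Require Import all_boot all_order all_algebra.
From mathcomp Require Import all_classical all_reals all_analysis.

Set Implicit Arguments.
Unset Strict Implicit.
Unset Printing Implicit Defensive.

Import Order.TTheory GRing.Theory Num.Theory.
Import numFieldNormedType.Exports.

Local Open Scope classical_set_scope.
Local Open Scope card_scope.
Local Open Scope ring_scope.

(* Distances below take values in [\bar R], because they are built from infima
   of extended real numbers; the Bourdon and Hamenstädt distances are finite. *)

Definition metric_ball (R : realType) (T : Type) (E : set T)
    (d : T -> T -> \bar R) (x : T) (r : R) : set T :=
  [set y | E y /\ (d x y < r%:E)%E].

Definition doubling (R : realType) (T : Type) (E : set T)
    (d : T -> T -> \bar R) : Prop :=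
  exists C : nat, forall (x : T) (r : R), E x -> 0 < r ->
    exists F : set T, [/\ F `<=` E, F #<= `I_C &
      metric_ball E d x r `<=` \bigcup_(z in F) metric_ball E d z (r / 2)].

Definition chain_dist (R : realType) (T : Type) (E : set T)
    (rho : T -> T -> \bar R) (x y : T) : \bar R :=
  ereal_inf [set s | exists (n : nat) (c : nat -> T),
    [/\ (0 < n)%N, c 0%N = x, c n = y, forall i, (i <= n)%N -> E (c i) &
        s = (\sum_(i < n) rho (c i) (c i.+1))%E]].

Section gromov.
Context {R : realType} {X : metricType R}.
Implicit Types (x y z w : X) (a b : nat -> X) (xi eta : set (nat -> X)).

Definition gromov_product w x y : R :=
  (mdist x w + mdist y w - mdist x y) / 2.

(* The convergences below do not depend on the base point. *)
Definition gromov_sequence a : Prop :=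
  forall w, gromov_product w (a p.1) (a p.2) @[p --> (\oo, \oo)] --> +oo.

Definition gromov_equiv a b : Prop :=
  forall w, gromov_product w (a i) (b i) @[i --> \oo] --> +oo.

Definition point_boundary_product w x eta : \bar R :=
  ereal_inf [set limn_einf (fun i => (gromov_product w x (b i))%:E) |
             b in eta].

(* For a base function [g], this is the infimum of liminf g(a_i, b_i) over
   representatives; it is used for both (.|.)_w and (.|.)_b. *)
Definition boundary_product (g : X -> X -> R) xi eta : \bar R :=
  ereal_inf [set limn_einf (fun i => (g (a i) (b i))%:E) |
             a in xi & b in eta].

Definition visual_rho (g : X -> X -> R) (eps : R) xi eta : \bar R :=
  expeR (- (eps%:E * boundary_product g xi eta))%E.

(* For [xi] in the boundary, 0 <= (x|xi)_w <= d(x,w), so [fine] only casts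
   finite values to [R]. *)
Definition busemann xi w x : R :=
  fine (point_boundary_product x w xi) - fine (point_boundary_product w x xi).

Definition busemann_product xi w x y : R :=
  (busemann xi w x + busemann xi w y - mdist x y) / 2.

End gromov.

Definition gromov_hyperbolic (R : realType) (X : metricType R) (delta : R) :
    Prop :=
  forall x y z w : X,
    Num.min (gromov_product w x z) (gromov_product w z y) - delta
      <= gromov_product w x y.

Definition gromov_boundary (R : realType) (X : metricType R) :
    set (set (nat -> X)) :=
  [set xi | exists2 a, gromov_sequence a &
            xi = [set b | gromov_sequence b /\ gromov_equiv a b]].
Arguments gromov_boundary {R} X _.

Definition punctured_boundary (R : realType) (X : metricType R)
    (xi : set (nat -> X)) : set (set (nat -> X)) :=
  gromov_boundary X `\ xi.

Definition bourdon_metric (R : realType) (X : metricType R) (w : X) (eps : R) :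
    set (nat -> X) -> set (nat -> X) -> \bar R :=
  chain_dist (gromov_boundary X) (visual_rho (gromov_product w) eps).

Definition hamenstadt_metric (R : realType) (X : metricType R)
    (xi : set (nat -> X)) (w : X) (eps : R) :
    set (nat -> X) -> set (nat -> X) -> \bar R :=
  chain_dist (punctured_boundary xi) (visual_rho (busemann_product xi w) eps).

(* eps < min(1, 1 / (5 delta)), where 1 / 0 is read as +oo. *)
Definition bourdon_parameter (R : realType) (delta eps : R) : Prop :=
  [/\ 0 < eps, eps < 1 & 5 * delta * eps < 1].

Definition hamenstadt_parameter (R : realType) (delta eps : R) : Prop :=
  0 < eps /\ expR (22 * eps * delta) <= 2.

(* Main.v *)
Require Import Defs.
From mathcomp Require Import all_boot all_order all_algebra.
From mathcomp Require Import all_classical all_reals all_analysis.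
From mathcomp Require Import ring lra zify.

Set Implicit Arguments.
Unset Strict Implicit.
Unset Printing Implicit Defensive.

Import Order.TTheory GRing.Theory Num.Theory.
Import numFieldNormedType.Exports.

Local Open Scope classical_set_scope.
Local Open Scope card_scope.
Local Open Scope ring_scope.

(** Both metrics are comparable, up to a factor 2, to the exponential
    [exp (- eps * g)] of a boundary product [g]: the Gromov product
    [p = (.|.)_w] for the Bourdon metric and the Busemann product
    [q = (.|.)_b] for the Hamenstädt metric. The lower bound on the chain
    infimum comes from halving chains ([le_chain_sum]). Taking logarithms,
    doubling becomes a property of the product alone, [scale_doubling]: for each
    gain [A], every set on which [g >= t] can be coloured with boundedly many
    colours, uniformly in [t], so that [g >= t + A] on each colour class
    ([doubling_scaleP]). No parameter [eps] and no ball centre is left in it, so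
    different parameters on the two sides, and the change of base point, cost
    nothing.

    The two products are related by an inversion with pole [xi]. Writing
    [h eta = p xi eta], which is finite for [eta <> xi], one has
      [q eta zeta = p eta zeta - h eta - h zeta]
    up to a bounded error ([busemann_to_gromov], [gromov_to_busemann]): indeed
    [b x] differs boundedly from [d (x, a_j) - d (w', a_j)] for [a] tending to
    [xi] and [j] large, hence from [d (x, w') - 2 (a_j|x)], and [(a_j|x)]
    settles near [h eta] when [x] runs to [eta].

    It remains to see that [scale_doubling] is invariant under the inversion
    ([scale_doubling_puncture], [scale_doubling_fill]). Where [h] is almost
    constant on a set, [p] and [q] differ there by an almost constant amount,
    and a colouring for one serves for the other. Given a set [S] to be
    coloured, the three-point inequality through [xi] shows that the points of
    [S] for which [h] lies beyond a suitable threshold may share one colour,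
    and that [h] oscillates boundedly on the others. *)

(** * Chain distances *)

Section chain_distance.
Context {R : realType} {T : Type}.
Implicit Types (E : set T) (rho : T -> T -> \bar R).

(** A weak ultrametric inequality along paths of three steps. It is stated for
    three steps, not two, because cutting a chain at its middle link leaves
    three pieces, and the factor 2 must not be paid twice. *)
Definition four_point_bound E rho :=
  forall x y z t (r : R), E x -> E y -> E z -> E t -> 0 < r ->
    (rho x y <= r%:E)%E -> (rho y z <= r%:E)%E -> (rho z t <= r%:E)%E ->
    (rho x t <= (2 * r)%:E)%E.

(** Take the last [k] for which the first [k] links weigh at most half of the
    total: either the [k]-th link is the last one, or the links up to and
    including it weigh more than half, which leaves at most half for those
    behind it. *)
Lemma chain_half_cut (u : nat -> R) n : (0 < n)%N -> (forall i, 0 < u i) ->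
  exists2 k, (k < n)%N &
    2 * \sum_(0 <= i < k) u i <= \sum_(0 <= i < n) u i /\
    2 * \sum_(0 <= i < n - k.+1) u (i + k.+1)%N <= \sum_(0 <= i < n) u i.
Proof.
move=> n0 u0; set s := \sum_(0 <= i < n) u i.
have sge0 : 0 <= s by apply: sumr_ge0 => i _; exact: ltW.
pose P k := (k < n)%N && (2 * \sum_(0 <= i < k) u i <= s).
have exP : exists k, P k by exists 0%N; rewrite /P n0 big_geq// mulr0.
have ubP k : P k -> (k <= n)%N by case/andP => /ltnW.
case: (ex_maxnP exP ubP) => k /andP[kn kP] maxk.
exists k => //; split=> //.
have [kn1|nk] := ltnP k.+1 n; last first.
  by rewrite [X in 2 * X]big_geq ?mulr0 // leqn0 subn_eq0.
have : ~~ P k.+1 by apply/negP => /maxk; rewrite ltnn.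
rewrite /P kn1 /= -ltNge.
have -> : s = \sum_(0 <= i < k.+1) u i + \sum_(0 <= i < n - k.+1) u (i + k.+1)%N.
  rewrite (_ : \sum_(0 <= i < n - k.+1) u (i + k.+1)%N =
    \sum_(0 + k.+1 <= i < n) u i); last by rewrite big_addn.
  by rewrite add0n -big_cat_nat.
lra.
Qed.

(** The metrization argument of Frink: cut the chain at the middle link, so that
    the induction hypothesis bounds both outer pieces by the total length [s];
    the middle link is at most [s] as well, and a single use of the four-point
    bound gives [2 * s]. *)
Lemma le_chain_sum E rho (c : nat -> T) (u : nat -> R) n :
  four_point_bound E rho -> (forall x, E x -> (rho x x <= 0)%E) ->
  (forall i, (i <= n)%N -> E (c i)) -> (forall i, 0 < u i) ->
  (forall i, (i < n)%N -> (rho (c i) (c i.+1) <= (u i)%:E)%E) ->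
  (rho (c 0%N) (c n) <= (2 * \sum_(0 <= i < n) u i)%:E)%E.
Proof.
move=> rho4 rho0; elim/ltn_ind: n c u => -[|n] IH c u Ec u0 cu.
  by rewrite big_geq// mulr0 rho0//; exact: Ec.
have [k kn [lek ger]] := @chain_half_cut u n.+1 isT u0.
set s := \sum_(0 <= i < n.+1) u i in lek ger *.
have uk : u k <= s.
  rewrite /s big_mkord (bigD1 (Ordinal kn))//= lerDl.
  by apply: sumr_ge0 => i _; exact: ltW.
have En i : (i <= n.+1)%N -> E (c i) by exact: Ec.
apply: (rho4 _ (c k) (c k.+1)); [exact: En|by apply: En; lia|by apply: En; lia
  |exact: En|exact: lt_le_trans uk| | |].
- apply: (@le_trans _ _ (2 * \sum_(0 <= i < k) u i)%:E); last by rewrite lee_fin.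
  by apply: IH => // i ik; [apply: En; lia|apply: cu; lia].
- by apply: (@le_trans _ _ (u k)%:E); [exact: cu|rewrite lee_fin].
- have := IH (n.+1 - k.+1)%N _ (fun i => c (i + k.+1)%N) (fun i => u (i + k.+1)%N).
  rewrite add0n subnK// => H; apply: (le_trans (H _ _ _ _)); rewrite ?lee_fin//.
  + lia.
  + by move=> i ik; apply: En; lia.
  + by move=> i ik; apply: cu; lia.
Qed.

Lemma chain_dist_le E rho x y : E x -> E y -> (chain_dist E rho x y <= rho x y)%E.
Proof.
move=> Ex Ey; apply: ereal_inf_lbound; exists 1%N.
exists (fun i => if i == 0%N then x else y).
by split=> // [i _|]; [case: ifP|rewrite big_ord1].
Qed.

(** The strict inequality leaves room to enlarge each link by the same [e], which
    makes all the weights positive as [le_chain_sum] requires. *)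
Lemma chain_dist_lt E rho x y (r : R) : four_point_bound E rho ->
  (forall x, E x -> (rho x x <= 0)%E) ->
  (forall x y, 0 <= rho x y)%E ->
  (chain_dist E rho x y < r%:E)%E -> (rho x y <= (2 * r)%:E)%E.
Proof.
move=> rho4 rho0 rho_ge0 /ereal_inf_lt[_ [n [c [n0 <- <- Ec ->]]]].
move=> sr.
have fin i : (i < n)%N -> rho (c i) (c i.+1) \is a fin_num.
  move=> ni; rewrite ge0_fin_numE//.
  apply: le_lt_trans (lt_trans sr (ltry r)).
  by rewrite (bigD1 (Ordinal ni))//= leeDl// sume_ge0.
pose v i := if (i < n)%N then fine (rho (c i) (c i.+1)) else 0.
have v0 i : 0 <= v i by rewrite /v; case: ifP => // _; exact: fine_ge0.
have rv i : (i < n)%N -> rho (c i) (c i.+1) = (v i)%:E.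
  by move=> ni; rewrite /v ni fineK// fin.
move: sr; rewrite (eq_bigr (fun i : 'I_n => (v i)%:E)); last first.
  by move=> i _; rewrite rv.
rewrite sumEFin lte_fin => sr.
pose e := (r - \sum_(i < n) v i) / n%:R.
have nR : 0 < n%:R :> R by rewrite ltr0n.
have e0 : 0 < e by rewrite divr_gt0// subr_gt0.
have := @le_chain_sum E rho c (fun i => v i + e) n rho4 rho0 Ec.
move=> /(_ (fun i => ltr_wpDl (v0 i) e0)).
have -> : \sum_(0 <= i < n) (v i + e) = r.
  rewrite big_mkord big_split/= sumr_const card_ord -mulr_natr /e.
  by rewrite divfK ?gt_eqF// addrC subrK.
apply=> i ni; rewrite rv// lee_fin; lra.
Qed.

End chain_distance.

(** * Doubling in terms of a product *)

Section scale_doubling.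
Context {R : realType} {T : Type}.
Implicit Types (E S : set T) (p : T -> T -> \bar R).

(** The logarithmic form of doubling. Subsets that are bounded at level [t]
    replace balls, and colour classes replace the covering balls, so that there
    are no centres to keep inside [E] when [E] changes. *)
Definition scale_doubling E p := forall A : R, 0 <= A ->
  exists C : nat, forall (t : R) S, S `<=` E ->
    (forall x y, S x -> S y -> (t%:E <= p x y)%E) ->
    exists f : T -> nat, (forall x, S x -> (f x < C)%N) /\
      forall x y, S x -> S y -> f x = f y -> ((t + A)%:E <= p x y)%E.

(** What Gromov hyperbolicity gives along three steps; it becomes
    [four_point_bound] for [exp (- eps * p)] when [exp (eps * c) <= 2]. *)
Definition four_point_product E p (c : R) := forall x y z t (s : R),
  E x -> E y -> E z -> E t ->
  (s%:E <= p x y)%E -> (s%:E <= p y z)%E -> (s%:E <= p z t)%E ->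
  ((s - c)%:E <= p x t)%E.

Lemma visual_le (eps t : R) (a : \bar R) : 0 < eps ->
  (expeR (- (eps%:E * a)) <= (expR (- (eps * t)))%:E)%E = (t%:E <= a)%E.
Proof.
move=> eps0; case: a => [r| |].
- by rewrite -EFinM -EFinN lee_fin ler_expR lerN2 ler_pM2l// lee_fin.
- by rewrite mulry gtr0_sg// mul1e leey lee_fin expR_ge0.
- by rewrite mulrNy gtr0_sg// mul1e/= !leeNy_eq.
Qed.

Lemma visual_le_pos (eps r : R) (a : \bar R) : 0 < eps -> 0 < r ->
  (expeR (- (eps%:E * a)) <= r%:E)%E = ((- (ln r / eps))%:E <= a)%E.
Proof.
move=> eps0 r0; rewrite -(visual_le _ _ eps0) mulrN opprK mulrC divfK ?gt_eqF//.
by rewrite lnK.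
Qed.

Lemma visual_four_point E p (eps c : R) : 0 < eps -> expR (eps * c) <= 2 ->
  four_point_product E p c ->
  four_point_bound E (fun x y => expeR (- (eps%:E * p x y)))%E.
Proof.
move=> eps0 epsc p4 x y z t r Ex Ey Ez Et r0.
rewrite !(visual_le_pos _ eps0 r0) => xy yz zt.
have := p4 _ _ _ _ _ Ex Ey Ez Et xy yz zt.
rewrite -(visual_le _ _ eps0) => /le_trans; apply; rewrite lee_fin.
rewrite mulrBr mulrN opprD !opprK mulrC divfK ?gt_eqF// expRD lnK// mulrC.
by rewrite ler_wpM2r// ltW.
Qed.

(** Comparing a metric with a quasi-metric costs constant factors, which a single
    halving of the radius cannot absorb; hence the iteration. The centres are
    listed by a sequence, so that those of step [k.+1] are numbered by
    [i * C0 + j]. *)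
Lemma doubling_iter E (d : T -> T -> \bar R) k : doubling E d ->
  exists C : nat, forall x r, E x -> 0 < r ->
    exists z : nat -> T, (forall i, E (z i)) /\
      forall y, metric_ball E d x r y ->
        exists2 i, (i < C)%N & (d (z i) y < (r / 2 ^+ k)%:E)%E.
Proof.
move=> [C0 HC0].
have step x r : E x -> 0 < r -> exists z : nat -> T, (forall i, E (z i)) /\
      forall y, metric_ball E d x r y ->
        exists2 i, (i < C0)%N & (d (z i) y < (r / 2)%:E)%E.
  move=> Ex r0; have [F [FE /pcard_leP[g] Fcov]] := HC0 _ _ Ex r0.
  have /choice[z zP] : forall i, exists z, E z /\ (forall y, F y -> g y = i -> z = y).
    move=> i; have [[y [Fy gy]]|no] := pselect (exists y, F y /\ g y = i).
      exists y; split=> [|y' Fy' gy']; first exact: FE.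
      by apply: (@inj _ _ F g); rewrite ?inE //= gy gy'.
    by exists x; split=> // y Fy gy; case: no; exists y.
  exists z; split=> [i|y /Fcov[y' Fy' [_ y'y]]]; first exact: (zP i).1.
  exists (g y'); first exact: (@funS _ _ F `I_C0 g).
  by rewrite ((zP (g y')).2 y').
elim: k => [|k [C HC]].
  exists 1%N => x r Ex r0; exists (fun=> x); split=> // y [_ xy].
  by exists 0%N => //; rewrite expr0 divr1.
exists (C * C0)%N => x r Ex r0; have [z [Ez zP]] := HC _ _ Ex r0.
have rk : 0 < r / 2 ^+ k by rewrite divr_gt0// exprn_gt0.
have /choice[z' z'P] := fun i => step (z i) _ (Ez i) rk.
exists (fun m => z' (m %/ C0)%N (m %% C0)%N); split=> [m|y yb].
  exact: (z'P _).1.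
have [i iC iy] := zP _ yb.
have [j jC jy] := (z'P i).2 y (conj yb.1 iy).
have C00 : (0 < C0)%N by exact: leq_ltn_trans jC.
exists (i * C0 + j)%N; first by nia.
rewrite divnMDl// modnMDl modn_small// divn_small// addn0.
by rewrite exprS [2 * _]mulrC invfM mulrA.
Qed.

End scale_doubling.

Section doubling_scaleP.
Context {R : realType} {T : Type}.
Variables (E : set T) (p : T -> T -> \bar R) (eps c : R).
Hypotheses (eps_gt0 : 0 < eps) (epsc : expR (eps * c) <= 2).
Hypotheses (p4 : four_point_product E p c)
  (p_sym : forall x y, E x -> E y -> p x y = p y x)
  (p_diag : forall x, E x -> p x x = +oo%E).

Local Notation rho := (fun x y => expeR (- (eps%:E * p x y)))%E.
Local Notation d := (chain_dist E rho).

Lemma three_point_product x y z s : E x -> E y -> E z ->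
  (s%:E <= p x y)%E -> (s%:E <= p y z)%E -> ((s - c)%:E <= p x z)%E.
Proof.
move=> Ex Ey Ez xy yz; apply: (p4 Ex Ey Ez Ez xy yz).
by rewrite p_diag// leey.
Qed.

Lemma visual_diag x : E x -> (rho x x <= 0)%E.
Proof. by move=> Ex; rewrite /= p_diag// mulry gtr0_sg// mul1e. Qed.

Lemma dist_lt_visual x y (r : R) : (d x y < r%:E)%E -> (rho x y <= (2 * r)%:E)%E.
Proof.
apply: chain_dist_lt.
- exact: visual_four_point epsc p4.
- exact: visual_diag.
- by move=> *; exact: expeR_ge0.
Qed.

(** A set at level [t] lies in the ball of radius [2 * exp (- eps * t)] about any
    of its points. Cover this ball by balls [2 ^ k] times smaller and colour a
    point by the number of a ball containing it: two points of one ball are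
    joined through its centre, at a loss of [c] and of a factor 2. *)
Lemma scale_doubling_of_doubling : doubling E d -> scale_doubling E p.
Proof.
move=> dbl A A0.
have [k kP] : exists k, 4 * expR (eps * (A + c)) <= 2 ^+ k.
  have := archi_boundP (ltW (expR_gt0 (eps * (A + c)))).
  set m := Num.bound _ => Xm; exists (2 + m)%N.
  rewrite exprD (_ : 2 ^+ 2 = 4) ?ler_pM2l//; last by ring.
  by apply: (le_trans (ltW Xm)); rewrite -natrX ler_nat ltnW// ltn_expl.
have [C HC] := doubling_iter k dbl.
exists C => t S SE St.
have [[x Sx]|S0] := pselect (S !=set0); last first.
  by exists (fun=> 0%N); split=> [x Sx|x y Sx]; case: S0; exists x.
pose r := 2 * expR (- (eps * t)).
have r0 : 0 < r by rewrite mulr_gt0// expR_gt0.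
have [z [Ez zP]] := HC _ _ (SE _ Sx) r0.
have bS y : S y -> metric_ball E d x r y.
  move=> Sy; split; first exact: SE.
  apply: (le_lt_trans (chain_dist_le _ (SE _ Sx) (SE _ Sy))).
  apply: (@le_lt_trans _ _ (expR (- (eps * t)))%:E).
    by rewrite visual_le// St.
  by rewrite lte_fin /r ltr_pMl ?expR_gt0// ltr1n.
have zp i y : (d (z i) y < (r / 2 ^+ k)%:E)%E -> ((t + A + c)%:E <= p (z i) y)%E.
  move=> /dist_lt_visual H; rewrite -(visual_le _ _ eps_gt0).
  apply: (le_trans H).
  have -> : - (eps * (t + A + c)) = - (eps * t) - eps * (A + c) by ring.
  rewrite lee_fin /r expRB ler_pdivlMr ?expR_gt0//.
  have K0 : 0 < 2 ^+ k :> R by rewrite exprn_gt0.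
  move: kP K0; set b := expR (eps * _); set K := 2 ^+ k => bK K0.
  set a := expR _; rewrite (_ : 2 * (2 * a / K) * b = a * (4 * b) / K).
    by rewrite ler_pdivrMr// ler_pM2l ?expR_gt0.
  by field; rewrite gt_eqF.
have /choice[f fP] : forall y, exists i, S y -> (i < C)%N /\
    ((t + A + c)%:E <= p (z i) y)%E.
  move=> y; have [/bS/zP[i iC iy]|nSy] := pselect (S y).
    by exists i; split=> //; exact: zp.
  by exists 0%N.
exists f; split=> [y /fP[]//|y y' Sy Sy' ff].
have [Ey Ey'] := (SE _ Sy, SE _ Sy').
rewrite -[t + A](addrK c); apply: (@three_point_product _ (z (f y))) => //.
- by rewrite p_sym//; exact: (fP _ Sy).2.
- by rewrite ff; exact: (fP _ Sy').2.
Qed.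

(** A gain of [ln 16 / eps] divides the quasi-metric by 16: a factor 2 is lost
    when passing from the metric to the quasi-metric, another one when
    comparing two points of a ball through its centre, and a quarter of the
    radius remains. The new centres are one point from each colour class. *)
Lemma doubling_of_scale_doubling : scale_doubling E p -> doubling E d.
Proof.
have ln16 : 0 <= ln (16 : R) by rewrite ln_ge0// ler1n.
move=> /(_ (ln 16 / eps))[|C HC]; first by rewrite divr_ge0// ltW.
exists C => x r Ex r0.
pose t := - (ln (2 * r) / eps).
have r20 : 0 < 2 * r by rewrite mulr_gt0.
have bp y : metric_ball E d x r y -> (t%:E <= p x y)%E.
  by move=> [_ /dist_lt_visual]; rewrite visual_le_pos.
have bE : metric_ball E d x r `<=` E by move=> y [].
have [y z bx bz|f [fC fp]] := HC (t - c) _ bE.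
  have [Ey Ez] := (bE _ bx, bE _ bz).
  by apply: (@three_point_product _ x) => //; [rewrite p_sym//|]; exact: bp.
have /choice[z zP] : forall i, exists z, E z /\
    forall y, metric_ball E d x r y -> f y = i -> metric_ball E d x r z /\ f z = i.
  move=> i.
  have [[z [bz fz]]|no] := pselect (exists z, metric_ball E d x r z /\ f z = i).
    by exists z; split=> //; exact: bE.
  by exists x; split=> // y yb fy; case: no; exists y.
exists [set z i | i in `I_C]; split.
- by move=> _ [i _ <-]; exact: (zP i).1.
- exact: card_image_le.
- move=> y yb; have [zb fz] := (zP (f y)).2 y yb erefl.
  exists (z (f y)); first by exists (f y) => //; exact: fC.
  have [Ez Ey] := (bE _ zb, bE _ yb); split=> //.
  apply: (le_lt_trans (chain_dist_le _ Ez Ey)).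
  have := fp _ _ zb yb fz; rewrite -(visual_le _ _ eps_gt0) => /le_lt_trans; apply.
  have -> : - (eps * (t - c + ln 16 / eps)) = ln (2 * r) - ln 16 + eps * c.
    by rewrite /t; field; rewrite gt_eqF.
  rewrite lte_fin expRD expRB !lnK ?posrE//.
  apply: (@le_lt_trans _ _ (2 * r / 16 * 2)); last by lra.
  by rewrite ler_pM2l// divr_gt0.
Qed.

Lemma doubling_scaleP : doubling E d <-> scale_doubling E p.
Proof.
by split; [exact: scale_doubling_of_doubling|exact: doubling_of_scale_doubling].
Qed.

End doubling_scaleP.

(** * Invariance under inversion *)

(** Here [q] is obtained from [p] by the inversion with pole [xi], up to an
    additive error [M], and [h] is the product with the pole. *)
Section inversion.
Context {R : realType} {T : Type}.
Variables (E : set T) (xi : T) (p q : T -> T -> \bar R) (h : T -> R) (c M : R).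
Hypotheses (c_ge0 : 0 <= c) (M_ge0 : 0 <= M) (Exi : E xi).
Hypotheses (p_sym : forall x y, E x -> E y -> p x y = p y x)
  (p3 : forall x y z s, E x -> E y -> E z ->
    (s%:E <= p x y)%E -> (s%:E <= p y z)%E -> ((s - c)%:E <= p x z)%E).
Hypotheses (p_xi : p xi xi = +oo%E)
  (ph : forall x, (E `\ xi) x -> p xi x = (h x)%:E).
Hypotheses (q_to_p : forall x y s, (E `\ xi) x -> (E `\ xi) y ->
    (s%:E <= q x y)%E -> ((s + h x + h y - M)%:E <= p x y)%E)
  (p_to_q : forall x y s, (E `\ xi) x -> (E `\ xi) y ->
    (s%:E <= p x y)%E -> ((s - h x - h y - M)%:E <= q x y)%E).

Lemma pole_product x y : (E `\ xi) x -> (E `\ xi) y ->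
  ((Num.min (h x) (h y) - c)%:E <= p x y)%E.
Proof.
move=> Ex Ey; apply: (p3 Ex.1 Exi Ey.1).
- by rewrite p_sym//; [rewrite ph// lee_fin ge_min lexx|exact: Ex.1].
- by rewrite ph// lee_fin ge_min lexx orbT.
Qed.

Lemma pole_height x y s : (E `\ xi) x -> (E `\ xi) y ->
  (s%:E <= p x y)%E -> Num.min (h x) s - c <= h y.
Proof.
move=> Ex Ey sxy; rewrite -lee_fin -ph//; apply: (p3 Exi Ex.1 Ey.1).
- by rewrite ph// lee_fin ge_min lexx.
- by apply: le_trans sxy; rewrite lee_fin ge_min lexx orbT.
Qed.

(** For points [x] and [y] of the set with [h x >= h y], the inequality
    [h y >= min (h x) (p x y) - c] leaves two cases: either [h x] exceeds [h y]
    by at most [c], or [h x] is bounded above in terms of [- t], because [p] is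
    at least [t + h x + h y] up to [M]. So [h] oscillates by at most [K] on the
    points where [h >= - t - A'], and there a colouring for [p] is one for [q].
    On the other points, passing through the pole already gives
    [q >= - max (h x) (h y)], up to a constant, and one colour is enough. *)
Lemma scale_doubling_puncture :
  scale_doubling E p -> scale_doubling (E `\ xi) q.
Proof.
have [c0 M0] := (c_ge0, M_ge0); move=> dbl A A0.
pose A' := A + c + M; pose K := M + c + A'.
have A'0 : 0 <= A' by rewrite /A'; lra.
(* Freezing [h] at [h x0] costs [2 * K] and an exchange of the products costs
   [M]; both happen twice, before and after the colouring. *)
have [|C HC] := dbl (A + 4 * K + 2 * M); first by rewrite /K; lra.
exists C.+1 => t S SE St.
pose S1 := [set x | S x /\ - t - A' <= h x].
have S1E : S1 `<=` E by move=> x [/SE[]].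
have near_h x y : S1 x -> S1 y -> h x <= h y + K.
  move=> [Sx hx] [Sy hy].
  have := pole_height (SE _ Sx) (SE _ Sy) (q_to_p (SE _ Sx) (SE _ Sy) (St _ _ Sx Sy)).
  by rewrite minEle /K; case: ifP => _; lra.
have [g [gC gp]] : exists g : T -> nat, (forall x, S1 x -> (g x < C)%N) /\
    forall x y, S1 x -> S1 y -> g x = g y -> ((t + A)%:E <= q x y)%E.
  have [[x0 S1x0]|S10] := pselect (S1 !=set0); last first.
    by exists (fun=> 0%N); split=> [x S1x|x y S1x]; case: S10; exists x.
  have [|g [gC gp]] := HC (t + 2 * h x0 - 2 * K - M) S1 S1E.
    move=> x y Sx Sy; have Ex := SE _ Sx.1; have Ey := SE _ Sy.1.
    apply: le_trans (q_to_p Ex Ey (St _ _ Sx.1 Sy.1)).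
    have := near_h _ _ S1x0 Sx; have := near_h _ _ S1x0 Sy.
    by rewrite lee_fin; lra.
  exists g; split=> // x y Sx Sy gxy; have Ex := SE _ Sx.1; have Ey := SE _ Sy.1.
  apply: le_trans (p_to_q Ex Ey (gp _ _ Sx Sy gxy)).
  have := near_h _ _ Sx S1x0; have := near_h _ _ Sy S1x0.
  by rewrite lee_fin; lra.
exists (fun x => if - t - A' <= h x then (g x).+1 else 0%N).
split=> [x Sx|x y Sx Sy].
  by case: ifP => // hx; rewrite ltnS gC.
case: ifPn => hx; case: ifPn => hy //; first by move=> [gxy]; exact: gp.
move=> _.
have Ex := SE _ Sx; have Ey := SE _ Sy.
apply: le_trans (p_to_q Ex Ey (pole_product Ex Ey)).
by move: hx hy; rewrite lee_fin -!ltNge /A' minEle; case: ifP; lra.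
Qed.

(** Points with [p xi x >= t + A + c], the pole among them, are joined through the
    pole at level [t + A] and share one colour. On the others [h] is at most
    [t + A + c], while [h y >= min (h x) t - c]; hence [h] oscillates by at most
    [A + 2 * c]. *)
Lemma scale_doubling_fill :
  scale_doubling (E `\ xi) q -> scale_doubling E p.
Proof.
have [c0 M0] := (c_ge0, M_ge0); move=> dbl A A0; pose K := A + 2 * c.
have [|C HC] := dbl (A + 4 * K + 2 * M); first by rewrite /K; lra.
exists C.+1 => t S SE St.
pose far x := ((t + A + c)%:E <= p xi x)%E.
pose S1 := [set x | S x /\ ~~ far x].
have S1E : S1 `<=` E `\ xi.
  move=> x [Sx fx]; split; first exact: SE.
  by move=> /= xxi; move: fx; rewrite /far xxi p_xi leey.
have far_h x : S1 x -> h x < t + A + c.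
  by move=> S1x; have [_] := S1x; rewrite /far ph ?lee_fin ?ltNge//; exact: S1E.
have near_h x y : S1 x -> S1 y -> h x <= h y + K.
  move=> Sx Sy; have hx := far_h _ Sx.
  have := pole_height (S1E _ Sx) (S1E _ Sy) (St _ _ Sx.1 Sy.1).
  by rewrite minEle /K; case: ifP => _; lra.
have [g [gC gp]] : exists g : T -> nat, (forall x, S1 x -> (g x < C)%N) /\
    forall x y, S1 x -> S1 y -> g x = g y -> ((t + A)%:E <= p x y)%E.
  have [[x0 S1x0]|S10] := pselect (S1 !=set0); last first.
    by exists (fun=> 0%N); split=> [x S1x|x y S1x]; case: S10; exists x.
  have [|g [gC gp]] := HC (t - 2 * h x0 - 2 * K - M) S1 S1E.
    move=> x y Sx Sy.
    apply: le_trans (p_to_q (S1E _ Sx) (S1E _ Sy) (St _ _ Sx.1 Sy.1)).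
    have := near_h _ _ Sx S1x0; have := near_h _ _ Sy S1x0.
    by rewrite lee_fin; lra.
  exists g; split=> // x y Sx Sy gxy.
  apply: le_trans (q_to_p (S1E _ Sx) (S1E _ Sy) (gp _ _ Sx Sy gxy)).
  have := near_h _ _ S1x0 Sx; have := near_h _ _ S1x0 Sy.
  by rewrite lee_fin; lra.
exists (fun x => if far x then 0%N else (g x).+1); split=> [x Sx|x y Sx Sy].
  by case: ifPn => // hx; rewrite ltnS gC.
case: ifPn => hx; case: ifPn => hy //; last by move=> [gxy]; exact: gp.
move=> _.
rewrite -[t + A](addrK c); apply: (p3 (SE _ Sx) Exi (SE _ Sy)) => //.
by rewrite p_sym//; exact: SE.
Qed.

End inversion.

(** * Limits and boundary products *)

Section eventual_bounds.
Context {R : realType}.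

Lemma limn_einf_ge (u : nat -> R) (t : R) :
  (t%:E <= limn_einf (fun i => (u i)%:E))%E <->
  forall s, s < t -> exists N, forall n, (N <= n)%N -> s <= u n.
Proof.
rewrite limn_einf_lim (cvg_lim _ (@cvg_einfs_sup _ _))//; split=> [tu s st|H].
  have : (s%:E < ereal_sup (range (einfs (fun i => (u i)%:E))))%E.
    by apply: lt_le_trans tu; rewrite lte_fin.
  move=> /ereal_sup_gt[_ [N _ <-]] sN; exists N => n Nn.
  rewrite -lee_fin (le_trans (ltW sN))//.
  by apply: ereal_inf_lbound; exists n.
apply/lee_subgt0Pr => e e0; have [|N HN] := H (t - e); first by lra.
apply: le_ereal_sup_tmp; exists (einfs (fun i => (u i)%:E) N); first by exists N.
by apply/ereal_infP => _ [n Nn <-]; rewrite -EFinB lee_fin HN.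
Qed.

Lemma limn_einf_lt (u : nat -> R) (t : R) :
  (limn_einf (fun i => (u i)%:E) < t%:E)%E ->
  exists2 s, s < t & forall N, exists2 n, (N <= n)%N & u n < s.
Proof.
move=> ut; apply: contrapT => no; move: ut; apply/negP; rewrite -leNgt.
apply/limn_einf_ge => s st; apply: contrapT => noN.
apply: no; exists s => // N; apply: contrapT => non.
apply: noN; exists N => n Nn; rewrite leNgt; apply/negP => lts.
by apply: non; exists n.
Qed.

Lemma cvgn_pinftyP (u : nat -> R) : u i @[i --> \oo] --> +oo <->
  forall A, exists N, forall n, (N <= n)%N -> A <= u n.
Proof.
split=> [/cvgryPge H A|H]; first by have [N _ HN] := H A; exists N.
by apply/cvgryPge => A; have [N HN] := H A; exists N.
Qed.

Lemma cvgn2_pinftyP (u : nat * nat -> R) : u p @[p --> (\oo, \oo)] --> +oo <->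
  forall A, exists N, forall i j, (N <= i)%N -> (N <= j)%N -> A <= u (i, j).
Proof.
split=> [/cvgryPge H A|H].
  have [[P Q] /= [[N1 _ HP] [N2 _ HQ]] PQ] := H A.
  exists (maxn N1 N2) => i j; rewrite !geq_max => /andP[i1 _] /andP[_ j2].
  by apply: (PQ (i, j)); split; [exact: HP|exact: HQ].
apply/cvgryPge => A; have [N HN] := H A.
exists ([set i | (N <= i)%N], [set i | (N <= i)%N]) => /=.
  by split; exists N.
by move=> [i j] /= []; exact: HN.
Qed.

End eventual_bounds.

Section boundary.
Context {R : realType} {X : metricType R}.
Implicit Types (x y z w : X) (a b : nat -> X) (xi eta : set (nat -> X)).
Implicit Types (g : X -> X -> R).

Lemma boundary_product_ge g xi eta (t : R) :
  (t%:E <= boundary_product g xi eta)%E <->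
  forall a b, xi a -> eta b -> forall s, s < t ->
    exists N, forall n, (N <= n)%N -> s <= g (a n) (b n).
Proof.
split=> [/ereal_infP H a b Xa Eb|H].
  by apply/(limn_einf_ge (fun n => g (a n) (b n))); apply: H; exists a => //; exists b.
by apply/ereal_infP => _ [a Xa [b Eb <-]]; apply/limn_einf_ge => s; exact: H.
Qed.

Lemma point_boundary_product_ge w x eta (t : R) :
  (t%:E <= point_boundary_product w x eta)%E <->
  forall b, eta b -> forall s, s < t ->
    exists N, forall n, (N <= n)%N -> s <= gromov_product w x (b n).
Proof.
split=> [/ereal_infP H b Eb|H].
  by apply/(limn_einf_ge (fun n => gromov_product w x (b n))); apply: H; exists b.
by apply/ereal_infP => _ [b Eb <-]; apply/limn_einf_ge => s; exact: H.
Qed.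

Lemma boundary_product_sym g xi eta : (forall x y, g x y = g y x) ->
  boundary_product g xi eta = boundary_product g eta xi.
Proof.
move=> gC; congr ereal_inf; apply/seteqP.
by split=> _ [a Xa [b Eb <-]]; exists b => //; exists a => //;
   congr limn_einf; apply/funext => i; rewrite gC.
Qed.

(** Hyperbolicity passes to infima of lower limits without loss: the two
    intermediate sequences can be chosen once for all representatives of the
    end points. *)
Lemma boundary_product_four_point g (c : R) (E : set (set (nat -> X))) :
  (forall x y z t s, s <= g x y -> s <= g y z -> s <= g z t -> s - c <= g x t) ->
  (forall xi, E xi -> xi !=set0) ->
  four_point_product E (boundary_product g) c.
Proof.
move=> g4 E0 xi eta zeta om s Exi /E0[y Ey] /E0[z Ez] Eom.
move=> /boundary_product_ge H1 /boundary_product_ge H2 /boundary_product_ge H3.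
apply/boundary_product_ge => a b Xa Ob r rs.
have rcs : r + c < s by lra.
have [N1 HN1] := H1 _ _ Xa Ey _ rcs; have [N2 HN2] := H2 _ _ Ey Ez _ rcs.
have [N3 HN3] := H3 _ _ Ez Ob _ rcs.
exists (maxn N1 (maxn N2 N3)) => n; rewrite !geq_max => /and3P[n1 n2 n3].
by rewrite -(addrK c r); apply: (g4 _ (y n) (z n)); auto.
Qed.

Lemma gromov_product_sym w x y : gromov_product w x y = gromov_product w y x.
Proof. by rewrite /gromov_product (metric_sym x y) [mdist x w + _]addrC. Qed.

Lemma gromov_product_ge0 w x y : 0 <= gromov_product w x y.
Proof.
by have := metric_triangle x w y; rewrite /gromov_product (metric_sym w y); lra.
Qed.

Lemma gromov_product_le w x y : gromov_product w x y <= mdist x w.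
Proof.
by have := metric_triangle y x w; rewrite /gromov_product (metric_sym y x); lra.
Qed.

Lemma gromov_product_base w w' x y :
  gromov_product w x y <= gromov_product w' x y + mdist w w'.
Proof.
have := metric_triangle x w' w; have := metric_triangle y w' w.
by rewrite /gromov_product (metric_sym w' w); lra.
Qed.

Lemma gromov_sequenceP a : gromov_sequence a <-> forall w A, exists N,
  forall i j, (N <= i)%N -> (N <= j)%N -> A <= gromov_product w (a i) (a j).
Proof.
split=> H w; first exact/(cvgn2_pinftyP (fun p => gromov_product w (a p.1) (a p.2))).
exact/cvgn2_pinftyP.
Qed.

Lemma gromov_equivP a b : gromov_equiv a b <-> forall w A, exists N,
  forall i, (N <= i)%N -> A <= gromov_product w (a i) (b i).
Proof. by split=> H w; exact/cvgn_pinftyP. Qed.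

Variable delta : R.
Hypotheses (delta_ge0 : 0 <= delta) (hypX : gromov_hyperbolic X delta).

Lemma gromov_product_three_point w x y z s :
  s <= gromov_product w x y -> s <= gromov_product w y z ->
  s - delta <= gromov_product w x z.
Proof.
by move=> xy yz; apply: le_trans (hypX x z y w); rewrite lerD2r le_min xy yz.
Qed.

Lemma gromov_product_four_point w x y z t s :
  s <= gromov_product w x y -> s <= gromov_product w y z ->
  s <= gromov_product w z t -> s - 2 * delta <= gromov_product w x t.
Proof.
have d0 := delta_ge0.
move=> xy yz zt; have xz := gromov_product_three_point xy yz.
have : s - delta - delta <= gromov_product w x t.
  by apply: gromov_product_three_point xz _; lra.
lra.
Qed.

Lemma gromov_equiv_refl a : gromov_sequence a -> gromov_equiv a a.
Proof.
move=> /gromov_sequenceP H; apply/gromov_equivP => w A.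
by have [N HN] := H w A; exists N => i Ni; exact: HN.
Qed.

Lemma gromov_equiv_sym a b : gromov_equiv a b -> gromov_equiv b a.
Proof.
move=> /gromov_equivP H; apply/gromov_equivP => w A.
by have [N HN] := H w A; exists N => i Ni; rewrite gromov_product_sym HN.
Qed.

Lemma gromov_equiv_trans a b c : gromov_equiv a b -> gromov_equiv b c ->
  gromov_equiv a c.
Proof.
move=> /gromov_equivP ab /gromov_equivP bc; apply/gromov_equivP => w A.
have [N1 H1] := ab w (A + delta); have [N2 H2] := bc w (A + delta).
exists (maxn N1 N2) => i; rewrite geq_max => /andP[i1 i2].
by rewrite -(addrK delta A); apply: (@gromov_product_three_point w _ (b i)); auto.
Qed.

Lemma boundary_nonempty xi : gromov_boundary X xi -> xi !=set0.
Proof. by move=> [a ga ->]; exists a; split=> //; exact: gromov_equiv_refl. Qed.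

Lemma boundary_eq xi eta a b : gromov_boundary X xi -> gromov_boundary X eta ->
  xi a -> eta b -> gromov_equiv a b -> xi = eta.
Proof.
move=> [a0 _ ->] [b0 _ ->] [ga aa] [gb bb] ab; apply/seteqP.
have a0b0 := gromov_equiv_trans (gromov_equiv_trans aa ab) (gromov_equiv_sym bb).
split=> c [gc cc]; split=> //.
- exact: gromov_equiv_trans (gromov_equiv_sym a0b0) cc.
- exact: gromov_equiv_trans a0b0 cc.
Qed.

(** Equivalence only compares terms of equal index; the Gromov property of [a]
    extends the bound to independent indices. *)
Lemma boundary_tends xi a b w A : gromov_boundary X xi -> xi a -> xi b ->
  exists N, forall i j, (N <= i)%N -> (N <= j)%N -> A <= gromov_product w (a i) (b j).
Proof.
move=> [c _ ->] [ga ca] [_ cb].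
have /gromov_equivP ab := gromov_equiv_trans (gromov_equiv_sym ca) cb.
move/gromov_sequenceP : ga => ga.
have [N1 H1] := ga w (A + delta); have [N2 H2] := ab w (A + delta).
exists (maxn N1 N2) => i j; rewrite !geq_max => /andP[i1 i2] /andP[j1 j2].
by rewrite -(addrK delta A); apply: (@gromov_product_three_point w _ (a j)); auto.
Qed.

Lemma boundary_product_diag w xi : gromov_boundary X xi ->
  boundary_product (gromov_product w) xi xi = +oo%E.
Proof.
move=> Bxi; apply/eqyP => A _; apply/boundary_product_ge => a b Xa Xb s sA.
have [N HN] := boundary_tends w A Bxi Xa Xb.
by exists N => n Nn; apply: (le_trans (ltW sA)); exact: HN.
Qed.

End boundary.

(** * Busemann functions *)

Section busemann.
Context {R : realType} {X : metricType R}.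
Variable delta : R.
Hypotheses (delta_ge0 : 0 <= delta) (hypX : gromov_hyperbolic X delta).
Implicit Types (x y z w : X) (a b : nat -> X) (xi eta : set (nat -> X)).

(** The lower limits along two representatives [a] and [b] of [xi] differ by at
    most [delta], since [(a_m|b_n)] tends to infinity. For the upper bound,
    compare [a] with a representative [b] nearly attaining the infimum. *)
Lemma point_product_end w x xi a (e : R) : gromov_boundary X xi -> xi a -> 0 < e ->
  exists N, forall n, (N <= n)%N ->
    fine (point_boundary_product w x xi) - e <= gromov_product w x (a n)
      <= fine (point_boundary_product w x xi) + delta + e.
Proof.
move=> Bxi Xa e0.
have ge0 : (0%:E <= point_boundary_product w x xi)%E.
  apply/point_boundary_product_ge => b _ s s0; exists 0%N => n _.
  by apply: (le_trans (ltW s0)); exact: gromov_product_ge0.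
have lty : ~ ((mdist x w + 1)%:E <= point_boundary_product w x xi)%E.
  move=> /point_boundary_product_ge /(_ _ Xa (mdist x w + 2^-1)).
  case=> [|N /(_ N (leqnn _))]; first by rewrite ltrD2l invf_lt1 ?ltr1n.
  apply/negP; rewrite -ltNge; apply: le_lt_trans (gromov_product_le _ _ _) _.
  by rewrite ltrDl invr_gt0.
have [v vE] : exists v, point_boundary_product w x xi = v%:E.
  move: ge0 lty; case: (point_boundary_product _ _ _) => [v| |] //.
    by move=> _ _; exists v.
  by move=> _ []; rewrite leey.
rewrite vE /=.
have lo : (v%:E <= point_boundary_product w x xi)%E by rewrite vE.
have [N1 H1] := (point_boundary_product_ge w x xi v).1 lo _ Xa (v - e) ltac:(lra).
have : (point_boundary_product w x xi < (v + e)%:E)%E by rewrite vE lte_fin ltrDl.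
move=> /ereal_inf_lt[_ [b Xb <-]].
move=> /(limn_einf_lt (u := fun i => gromov_product w x (b i)))[s sv freq].
have [N2 H2] := boundary_tends hypX w (s + delta) Bxi Xa Xb.
exists (maxn N1 N2) => m; rewrite geq_max => /andP[m1 m2].
rewrite H1//= leNgt; apply/negP => big.
have [n n2 ns] := freq N2.
have : s + delta - delta <= gromov_product w x (b n).
  apply: (gromov_product_three_point hypX (y := a m)); last exact: H2.
  lra.
lra.
Qed.

(** Replace both boundary products in the Busemann function by products with
    [a n]: the half-sums then combine to a difference of distances to [a n]. By
    [point_product_end] both replacements err upwards by at most [delta], so
    their difference errs by [delta], not twice that. *)
Lemma busemann_end w x xi a (e : R) : gromov_boundary X xi -> xi a -> 0 < e ->
  exists N, forall n, (N <= n)%N ->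
    `|busemann xi w x - (mdist (a n) x - mdist (a n) w)| <= delta + e.
Proof.
move=> Bxi Xa e0; have e20 : 0 < e / 2 by rewrite divr_gt0.
have [N1 H1] := point_product_end x w Bxi Xa e20.
have [N2 H2] := point_product_end w x Bxi Xa e20.
exists (maxn N1 N2) => n; rewrite geq_max => /andP[n1 n2].
move: (H1 n n1) (H2 n n2); rewrite /busemann.
set A := fine _; set B := fine _; rewrite /gromov_product.
rewrite (metric_sym w x) (metric_sym (a n) w) (metric_sym (a n) x).
move=> /andP[? ?] /andP[? ?]; rewrite ler_norml; apply/andP; split; lra.
Qed.

(** The Busemann product is nearly a Gromov product based at a point far out
    towards [xi], shifted by a constant. *)
Lemma busemann_product_end w x y xi a (e : R) :
  gromov_boundary X xi -> xi a -> 0 < e ->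
  exists N, forall n, (N <= n)%N ->
    `|busemann_product xi w x y
      - (gromov_product (a n) x y - mdist (a n) w)| <= delta + e.
Proof.
move=> Bxi Xa e0.
have [N1 H1] := busemann_end w x Bxi Xa e0.
have [N2 H2] := busemann_end w y Bxi Xa e0.
exists (maxn N1 N2) => n; rewrite geq_max => /andP[/H1 hx /H2 hy].
rewrite (_ : _ - _ = (busemann xi w x - (mdist (a n) x - mdist (a n) w)) / 2
    + (busemann xi w y - (mdist (a n) y - mdist (a n) w)) / 2); last first.
  rewrite /busemann_product /gromov_product !(metric_sym _ (a n)).
  by field.
rewrite (splitr (delta + e)); apply: (le_trans (ler_normD _ _)).
by rewrite lerD// normrM (@ger0_norm _ (2^-1)) ?ler_wpM2r ?invr_ge0.
Qed.

(** Apply hyperbolicity at the base point [a n]: the shift by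
    [mdist (a n) w] is common to all terms, so three steps cost [2 * delta], to
    which both passages between products add [delta]. *)
Lemma busemann_product_four_point xi w x y z t s : gromov_boundary X xi ->
  s <= busemann_product xi w x y -> s <= busemann_product xi w y z ->
  s <= busemann_product xi w z t ->
  s - 4 * delta <= busemann_product xi w x t.
Proof.
move=> Bxi; have [a Xa] := boundary_nonempty Bxi => xy yz zt.
apply/ler_addgt0Pr => e e0; have e20 : 0 < e / 2 by rewrite divr_gt0.
have [N1 H1] := busemann_product_end w x y Bxi Xa e20.
have [N2 H2] := busemann_product_end w y z Bxi Xa e20.
have [N3 H3] := busemann_product_end w z t Bxi Xa e20.
have [N4 H4] := busemann_product_end w x t Bxi Xa e20.
pose n := maxn (maxn N1 N2) (maxn N3 N4).
have [n1 n2 n3 n4] : [/\ (N1 <= n)%N, (N2 <= n)%N, (N3 <= n)%N & (N4 <= n)%N].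
  by rewrite !leq_max !leqnn !orbT.
pose s' := s + mdist (a n) w - delta - e / 2.
have near u v : s <= busemann_product xi w u v ->
    `|busemann_product xi w u v - (gromov_product (a n) u v - mdist (a n) w)|
      <= delta + e / 2 -> s' <= gromov_product (a n) u v.
  by rewrite ler_norml /s' => suv /andP[_]; lra.
have := gromov_product_four_point delta_ge0 hypX
  (near _ _ xy (H1 n n1)) (near _ _ yz (H2 n n2)) (near _ _ zt (H3 n n3)).
have /ler_normlP[+ _] := H4 n n4; clear; rewrite /s'; lra.
Qed.

(** Were the product infinite, representatives of [xi] and [eta] would be
    equivalent. Otherwise compare a pair [(a i, b j)] with a pair of equal
    index: a late pair [(a n, b n)] for the lower bound, and for the upper bound
    a late pair of representatives that nearly attain the infimum. *)
Lemma boundary_product_end w xi eta a b : gromov_boundary X xi ->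
  gromov_boundary X eta -> xi <> eta -> xi a -> eta b ->
  boundary_product (gromov_product w) xi eta \is a fin_num /\
  exists N, forall i j, (N <= i)%N -> (N <= j)%N ->
    `|gromov_product w (a i) (b j)
      - fine (boundary_product (gromov_product w) xi eta)| <= 1 + 2 * delta.
Proof.
move=> Bxi Beta xieta Xa Eb.
have ge0 : (0%:E <= boundary_product (gromov_product w) xi eta)%E.
  apply/boundary_product_ge => a' b' _ _ s s0; exists 0%N => n _.
  by apply: (le_trans (ltW s0)); exact: gromov_product_ge0.
have fin : boundary_product (gromov_product w) xi eta \is a fin_num.
  rewrite ge0_fin_numE// ltey; apply/eqP => /eqyP infty.
  apply: xieta; apply: (boundary_eq hypX Bxi Beta Xa Eb).
  apply/gromov_equivP => w' A.
  pose B := `|A| + mdist w w' + 1.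
  have B0 : 0 < B by rewrite /B ltr_wpDl// addr_ge0// mdist_ge0.
  have /boundary_product_ge/(_ _ _ Xa Eb (B - 1))[|N HN] := infty B B0.
    by rewrite ltrBlDr ltrDl.
  exists N => i /HN; have := gromov_product_base w w' (a i) (b i).
  by have := ler_norm A; rewrite /B; lra.
split=> //; move: fin => /fineK; set v := fine _ => vE.
have lo : (v%:E <= boundary_product (gromov_product w) xi eta)%E by rewrite vE.
have [N0 H0] := (boundary_product_ge _ _ _ _).1 lo _ _ Xa Eb (v - 1) ltac:(lra).
have : (boundary_product (gromov_product w) xi eta < (v + 1)%:E)%E.
  by rewrite -vE lte_fin ltrDl.
move=> /ereal_inf_lt[_ [a' Xa' [b' Eb' <-]]].
move=> /(limn_einf_lt (u := fun i => gromov_product w (a' i) (b' i)))[s sv freq].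
have [N1 H1] := boundary_tends hypX w (s + 2 * delta) Bxi Xa' Xa.
have [N2 H2] := boundary_tends hypX w (s + 2 * delta) Beta Eb Eb'.
have [N3 H3] := boundary_tends hypX w (v - 1) Bxi Xa Xa.
have [N4 H4] := boundary_tends hypX w (v - 1) Beta Eb Eb.
pose N := maxn N0 (maxn (maxn N1 N2) (maxn N3 N4)).
have [n0 n1 n2 [n3 n4]] : [/\ (N0 <= N)%N, (N1 <= N)%N, (N2 <= N)%N
    & (N3 <= N)%N /\ (N4 <= N)%N].
  by rewrite !leq_max !leqnn !orbT.
exists N => i j Ni Nj; rewrite ler_distl; apply/andP; split.
  have := gromov_product_four_point delta_ge0 hypX
    (H3 i N (leq_trans n3 Ni) n3) (H0 N n0) (H4 N j n4 (leq_trans n4 Nj)).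
  clear; lra.
have [n Nn ns] := freq N.
rewrite leNgt; apply/negP => big.
have big' : s + 2 * delta <= gromov_product w (a i) (b j) by move: big sv; clear; lra.
have := gromov_product_four_point delta_ge0 hypX
  (H1 n i (leq_trans n1 Nn) (leq_trans n1 Ni)) big'
  (H2 j n (leq_trans n2 Nj) (leq_trans n2 Nn)).
move: ns; clear; lra.
Qed.

End busemann.

(** * The Busemann product as an inversion *)

Section comparison.
Context {R : realType} {X : metricType R}.
Variable delta : R.
Hypotheses (delta_ge0 : 0 <= delta) (hypX : gromov_hyperbolic X delta).
Variables (xi : set (nat -> X)) (w w' : X).
Hypothesis Bxi : gromov_boundary X xi.

Local Notation p := (boundary_product (gromov_product w)).
Local Notation q := (boundary_product (busemann_product xi w')).
Local Notation h := (fun eta => fine (p xi eta)).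

(** The sum of [delta + 1] from [busemann_end], of twice the [1 + 2 * delta] from
    [boundary_product_end], and of twice the cost of the change of base point. *)
Definition height_error : R := 5 * delta + 3 + 2 * mdist w w'.

(** The half-sum of two height errors, the change of base point, and a slack of
    [1] for the lower limits. *)
Definition product_error : R := height_error + mdist w w' + 1.

Lemma product_error_ge0 : 0 <= product_error.
Proof.
have := mdist_ge0 w w'; have := delta_ge0.
by rewrite /product_error /height_error; lra.
Qed.

(** With [a] in [xi] and [k] fixed, choose [j] large: the Busemann function at
    [x = b k] is close to [d (a_j, x) - d (a_j, w') = d (x, w') - 2 (a_j|x)_w'],
    and [(a_j|x)] is close to [h eta] as soon as both indices are large. *)
Lemma busemann_height eta b : punctured_boundary xi eta -> eta b ->
  exists N, forall k, (N <= k)%N ->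
    `|busemann xi w' (b k) - (mdist (b k) w' - 2 * h eta)| <= height_error.
Proof.
move=> [Beta etaxi] Eb; have xieta : xi <> eta by move=> /esym.
have [a Xa] := boundary_nonempty Bxi.
have [_ [N HN]] := boundary_product_end delta_ge0 hypX w Bxi Beta xieta Xa Eb.
exists N => k Nk; have [N' HN'] := busemann_end hypX w' (b k) Bxi Xa ltr01.
pose j := maxn N N'.
have := HN' j (leq_maxr _ _); have := HN j k (leq_maxl _ _) Nk.
have := gromov_product_base w w' (a j) (b k).
have := gromov_product_base w' w (a j) (b k).
rewrite (metric_sym w' w).
have : gromov_product w' (a j) (b k) =
  (mdist (a j) w' + mdist (b k) w' - mdist (a j) (b k)) / 2 by [].
move: (gromov_product w' _ _) (fine _) (gromov_product w _ _).
move: (busemann _ _ _) => u g' v g.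
rewrite /height_error !ler_norml => ? ? ? /andP[? ?] /andP[? ?].
by apply/andP; split; lra.
Qed.

Lemma busemann_product_near eta zeta b c : punctured_boundary xi eta ->
  punctured_boundary xi zeta -> eta b -> zeta c ->
  exists N, forall k, (N <= k)%N ->
    `|busemann_product xi w' (b k) (c k)
       - (gromov_product w (b k) (c k) - h eta - h zeta)| <= product_error - 1.
Proof.
move=> Peta Pzeta Eb Zc.
have [N1 H1] := busemann_height Peta Eb; have [N2 H2] := busemann_height Pzeta Zc.
exists (maxn N1 N2) => k; rewrite geq_max => /andP[/H1 + /H2].
have := gromov_product_base w w' (b k) (c k).
have := gromov_product_base w' w (b k) (c k).
rewrite (metric_sym w' w) /busemann_product /product_error.
have : gromov_product w' (b k) (c k) =
  (mdist (b k) w' + mdist (c k) w' - mdist (b k) (c k)) / 2 by [].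
move: (gromov_product w' _ _) (fine _) (fine _) (gromov_product w _ _).
move: (busemann _ _ _) (busemann _ _ _).
move=> u u' g' v v' g; rewrite !ler_norml => ? ? ? /andP[? ?] /andP[? ?].
by apply/andP; split; lra.
Qed.

Lemma busemann_to_gromov eta zeta s :
  punctured_boundary xi eta -> punctured_boundary xi zeta ->
  (s%:E <= q eta zeta)%E -> ((s + h eta + h zeta - product_error)%:E <= p eta zeta)%E.
Proof.
move=> Peta Pzeta /boundary_product_ge H.
apply/boundary_product_ge => b c Eb Zc r rs.
have [|N1 H1] := H _ _ Eb Zc (s - 1); first by lra.
have [N2 H2] := busemann_product_near Peta Pzeta Eb Zc.
exists (maxn N1 N2) => k; rewrite geq_max => /andP[/H1 + /H2].
rewrite ler_norml => ? /andP[? ?]; lra.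
Qed.

Lemma gromov_to_busemann eta zeta s :
  punctured_boundary xi eta -> punctured_boundary xi zeta ->
  (s%:E <= p eta zeta)%E -> ((s - h eta - h zeta - product_error)%:E <= q eta zeta)%E.
Proof.
move=> Peta Pzeta /boundary_product_ge H.
apply/boundary_product_ge => b c Eb Zc r rs.
have [|N1 H1] := H _ _ Eb Zc (s - 1); first by lra.
have [N2 H2] := busemann_product_near Peta Pzeta Eb Zc.
exists (maxn N1 N2) => k; rewrite geq_max => /andP[/H1 + /H2].
rewrite ler_norml => ? /andP[? ?]; lra.
Qed.

Lemma busemann_product_diag eta : punctured_boundary xi eta -> q eta eta = +oo%E.
Proof.
move=> Peta; apply/eqyP => A _.
rewrite -(addrK (product_error + h eta + h eta) A).
rewrite (_ : _ - _ = A + (product_error + h eta + h eta) - h eta - h eta - product_error).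
  apply: gromov_to_busemann => //.
  by rewrite (boundary_product_diag hypX) ?leey//; exact: Peta.1.
ring.
Qed.

End comparison.


Theorem theorem1p1 (R : realType) (X : metricType R) (delta : R)
    (delta_ge0 : 0 <= delta) (hypX : gromov_hyperbolic X delta)
    (w : X) (eps : R) (heps : bourdon_parameter delta eps)
    (xi : set (nat -> X)) (hxi : gromov_boundary X xi)
    (w' : X) (eps' : R) (heps' : hamenstadt_parameter delta eps') :
  doubling (gromov_boundary X) (bourdon_metric w eps) <->
  doubling (punctured_boundary xi) (hamenstadt_metric xi w' eps').
Proof.
have [eps_gt0 _ eps_small] := heps; have [eps'_gt0 eps'_small] := heps'.
have gp4 : four_point_product (gromov_boundary X)
    (boundary_product (gromov_product w)) (2 * delta).
  apply: boundary_product_four_point; last exact: boundary_nonempty.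
  by move=> x y z t s; exact: (gromov_product_four_point delta_ge0 hypX).
have gp_sym eta zeta : boundary_product (gromov_product w) eta zeta =
    boundary_product (gromov_product w) zeta eta.
  by apply: boundary_product_sym => x y; exact: gromov_product_sym.
have gp_diag eta : gromov_boundary X eta ->
    boundary_product (gromov_product w) eta eta = +oo%E.
  exact: (boundary_product_diag hypX).
have bp4 : four_point_product (punctured_boundary xi)
    (boundary_product (busemann_product xi w')) (4 * delta).
  apply: boundary_product_four_point; last first.
    by move=> eta [Beta _]; exact: boundary_nonempty.
  by move=> x y z t s; exact: (busemann_product_four_point delta_ge0 hypX hxi).
(* Three steps cost [2 * delta] for the Gromov product and [4 * delta] for the
   Busemann product, within what [5 * delta * eps < 1] and
   [exp (22 * eps' * delta) <= 2] allow. *)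
have exp_eps : expR (eps * (2 * delta)) <= 2.
  rewrite -lef_pV2 ?posrE ?expR_gt0// -expRN.
  by apply: le_trans (expR_ge1Dx _); lra.
have exp_eps' : expR (eps' * (4 * delta)) <= 2.
  apply: le_trans eps'_small; rewrite ler_expR.
  by have := mulr_ge0 (ltW eps'_gt0) delta_ge0; lra.
apply: (iff_trans (doubling_scaleP eps_gt0 exp_eps gp4 _ gp_diag)) => //.
apply: (iff_trans _ (iff_sym (doubling_scaleP eps'_gt0 exp_eps' bp4 _ _))).
- have ph eta : punctured_boundary xi eta ->
    boundary_product (gromov_product w) xi eta =
      (fine (boundary_product (gromov_product w) xi eta))%:E.
    move=> [Beta etaxi].
    have [[a Xa] [b Eb]] := (boundary_nonempty hxi, boundary_nonempty Beta).
    rewrite fineK//.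
    by have [] := boundary_product_end delta_ge0 hypX w hxi Beta (nesym etaxi) Xa Eb.
  have d20 : 0 <= 2 * delta by rewrite mulr_ge0.
  have gp3 := three_point_product gp4 gp_diag.
  have M0 := product_error_ge0 delta_ge0 w w'.
  have q2p := @busemann_to_gromov _ _ _ delta_ge0 hypX xi w w' hxi.
  have p2q := @gromov_to_busemann _ _ _ delta_ge0 hypX xi w w' hxi.
  split.
  + exact: (scale_doubling_puncture d20 M0 hxi _ gp3 ph q2p p2q).
  + exact: (scale_doubling_fill d20 M0 hxi _ gp3 (gp_diag _ hxi) ph q2p p2q).
- move=> eta zeta _ _; apply: boundary_product_sym => x y.
  by rewrite /busemann_product metric_sym [busemann xi w' x + _]addrC.
- by move=> eta; exact: (busemann_product_diag delta_ge0 hypX w).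
Qed.
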